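(* Let $K_1,K_2,C_{111},C_{112},C_{122},C_{222}\in\mathbb{R}$ with $0<K_2<K_1<1$. For $u=(u^1,u^2,u^3,u^4)\in\mathbb{R}^4$ put $$d_1(u)=K_1+6C_{111}u^1+2C_{112}u^2,\quad d_2(u)=K_2+2C_{122}u^1+6C_{222}u^2,\quad c(u)=2C_{112}u^1+2C_{122}u^2,$$ $$a(u)=\begin{pmatrix}0&0&0&1\\0&0&-1&0\\-c(u)&-d_2(u)&0&0\\d_1(u)&c(u)&0&0\end{pmatrix}.$$ If $c\not\equiv0$ (i.e. $(C_{112},C_{122})\neq(0,0)$), then the system $\frac{\partial}{\partial t}u+a(u)\frac{\partial}{\partial x}u=0$ admits no Riemann invariants in any neighbourhood of $u=0$.
   Context: Near $u=0$ the matrix $a(u)$ has four distinct real eigenvalues $\lambda_i(u)$, $i=1,\ldots,4$. An eigen-$1$-form of $a$ for $\lambda_i$ is a nowhere vanishing $1$-form $e^{\star i}$ (row vector) with $e^{\star i}(u)a(u)=\lambda_i(u)e^{\star i}(u)$. The system admits Riemann invariants in a neighbourhood $V$ of $0$ (on which the eigenvalues are real and distinct) if there exist smooth coordinates $m=(m^1,\ldots,m^4)$ on $V$ such that the differentials $dm^i$ are each separately proportional to the elements of a basis $\{e^{\star i}\}_{i=1}^4$ of eigen-$1$-forms of $a$, i.e. there are functions $\mu_i$ on $V$ with $\mu_i\,dm^i=e^{\star i}$ for all $i\in\{1,\ldots,4\}$. *)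

(* Defs.v *)
From HB Require Import structures.
From mathcomp Require Import all_boot all_order all_algebra.
From mathcomp Require Import all_classical all_reals all_analysis.
Set Implicit Arguments.
Unset Strict Implicit.
Unset Printing Implicit Defensive.
Import Order.TTheory GRing.Theory Num.Theory.
Import numFieldNormedType.Exports.
Local Open Scope classical_set_scope.
Local Open Scope ring_scope.

Definition partial (R : realType) (n : nat) (i : 'I_n) (f : 'rV[R]_n -> R) :
    'rV[R]_n -> R :=
  fun u => 'D_(delta_mx 0 i) f u.

(* C^oo on V: every iterated partial derivative, f itself included, is
   (Frechet) differentiable at every point of V.  Meant for V open: then it only
   depends on f through its values on V. *)
Definition smooth_on (R : realType) (n : nat) (V : set 'rV[R]_n)
    (f : 'rV[R]_n -> R) : Prop :=
  forall s : seq 'I_n, forall u, V u ->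
    differentiable (foldr (@partial R n) f s) u.

Definition smooth_map_on (R : realType) (n p : nat) (V : set 'rV[R]_n)
    (m : 'rV[R]_n -> 'rV[R]_p) : Prop :=
  forall i : 'I_p, smooth_on V (fun u => m u 0 i).

(* A chart on the open set V, i.e. a smooth diffeomorphism of V onto an open
   subset of R^n; only the values of m on V matter. *)
Definition smooth_coordinates (R : realType) (n : nat) (V : set 'rV[R]_n)
    (m : 'rV[R]_n -> 'rV[R]_n) : Prop :=
  [/\ smooth_map_on V m,
      open (m @` V) &
      exists2 m' : 'rV[R]_n -> 'rV[R]_n,
        smooth_map_on (m @` V) m' & forall u, V u -> m' (m u) = u].

(* df at u as a row vector: its components on du^1, ..., du^n. *)
Definition differential (R : realType) (n : nat) (f : 'rV[R]_n -> R)
    (u : 'rV[R]_n) : 'rV[R]_n :=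
  \row_j 'd f u (delta_mx 0 j).

Definition distinct_eigenvalues_on (R : realType) (n : nat)
    (V : set 'rV[R]_n) (a : 'rV[R]_n -> 'M[R]_n)
    (lambda : 'I_n -> 'rV[R]_n -> R) : Prop :=
  forall u, V u ->
    injective (fun i => lambda i u) /\
    forall i, eigenvalue (a u) (lambda i u).

Definition eigen_form_on (R : realType) (n : nat)
    (V : set 'rV[R]_n) (a : 'rV[R]_n -> 'M[R]_n)
    (lambda : 'rV[R]_n -> R) (e : 'rV[R]_n -> 'rV[R]_n) : Prop :=
  forall u, V u -> e u != 0 /\ e u *m a u = lambda u *: e u.

(* No regularity is imposed on lambda, e and mu: once the conditions hold, the
   smooth forms dm^i are themselves a basis of eigen-1-forms (with mu = 1), so
   requiring smoothness would give an equivalent notion. *)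
Definition admits_riemann_invariants (R : realType) (n : nat)
    (a : 'rV[R]_n -> 'M[R]_n) (V : set 'rV[R]_n) : Prop :=
  exists (lambda : 'I_n -> 'rV[R]_n -> R)
         (e : 'I_n -> 'rV[R]_n -> 'rV[R]_n)
         (m : 'rV[R]_n -> 'rV[R]_n)
         (mu : 'I_n -> 'rV[R]_n -> R),
    [/\ distinct_eigenvalues_on V a lambda,
        forall i, eigen_form_on V a (lambda i) (e i),
        forall u, V u -> row_free (\matrix_i e i u),
        smooth_coordinates V m &
        forall i u, V u ->
          mu i u *: differential (fun v => m v 0 i) u = e i u].

(* The coordinates u^1, u^2 are u 0 0 and u 0 1. *)
Definition d1_fun (R : realType) (K1 C111 C112 : R) (u : 'rV[R]_4) : R :=
  K1 + 6 * C111 * u 0 0 + 2 * C112 * u 0 1.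

Definition d2_fun (R : realType) (K2 C122 C222 : R) (u : 'rV[R]_4) : R :=
  K2 + 2 * C122 * u 0 0 + 6 * C222 * u 0 1.

Definition c_fun (R : realType) (C112 C122 : R) (u : 'rV[R]_4) : R :=
  2 * C112 * u 0 0 + 2 * C122 * u 0 1.

Definition a_mx (R : realType) (K1 K2 C111 C112 C122 C222 : R)
    (u : 'rV[R]_4) : 'M[R]_4 :=
  let c := c_fun C112 C122 u in
  let d1 := d1_fun K1 C111 C112 u in
  let d2 := d2_fun K2 C122 C222 u in
  \matrix_(i < 4, j < 4)
    nth 0 (nth [::] [:: [::  0;   0;   0; 1];
                        [::  0;   0; - 1; 0];
                        [:: - c; - d2; 0; 0];
                        [::  d1;  c;   0; 0]] i) j.

(* Main.v *)
Require Import Defs.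
From HB Require Import structures.
From mathcomp Require Import all_boot all_order all_algebra.
From mathcomp Require Import all_classical all_reals all_analysis.
From mathcomp Require Import ring lra.
Set Implicit Arguments.
Unset Strict Implicit.
Unset Printing Implicit Defensive.
Import Order.TTheory GRing.Theory Num.Theory.
Import numFieldNormedType.Exports.
Local Open Scope classical_set_scope.
Local Open Scope ring_scope.

(** Let f be any one of the four Riemann invariants and p = df its gradient; p
is an eigen-1-form of a, with eigenvalue l say.  Writing out p a = l p gives
p1 = l p4, p2 = - l p3, and (p3, p4) is an eigenvector, for l^2, of the
symmetric matrix with rows (d2, - c) and (- c, d1).  Geometrically, all these
data depend on (u^1, u^2) only, and closedness of p forces the direction of
(p3, p4) to be constant; at u = 0 this direction is a coordinate axis, so the
off-diagonal entry c has to vanish identically.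

The proof is an infinitesimal version of this at the single point u = 0.
Eliminating l leaves three polynomial relations between the p_k, valid near 0
(eigen_form_relations):
  p1 p3 + p2 p4 = 0,
  c p4^2 + (d1 - d2) p3 p4 - c p3^2 = 0,
  p1^2 = (d1 p4 - c p3) p4.
Among the four distinct eigenvalues at 0 some l has l^2 <> K2, since a number
has at most two square roots (exists_sqr_neq); for the corresponding f one gets
p2 = p3 = 0 and p1, p4 <> 0 at 0.  Let H be the Hessian of f at 0.
Differentiating the second relation in the direction u^i gives
  (K1 - K2) H_i3 = - (d_i c) p4,
so that it suffices to see that H_13 = H_23 = 0.  As c and d1 do not
depend on u^3 and u^4, this same equation gives H_33 = H_43 = 0; then the first
relation differentiated along u^3 gives H_32 = 0, and the third one, together
with H_34 = H_43 = 0, gives H_31 = 0.  The symmetry of H (derive_comm) concludes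
(eigen_gradient_uncoupled).

Indices run from 1 here and from 0 in the code: p_k is p 0 (k - 1). *)

(** * Directional derivatives *)

Lemma is_derive_line (R : realType) (U : normedModType R) (f : U -> R)
    (a v : U) (s : R) :
  derivable f (a + s *: v) v ->
  is_derive s 1 (fun r : R => f (a + r *: v)) ('D_v f (a + s *: v)).
Proof.
have E : (fun h : R => h^-1 *: (f (a + (h *: 1 + s) *: v) - f (a + s *: v)))
    = (fun h : R => h^-1 *: (f (h *: v + (a + s *: v)) - f (a + s *: v))).
  apply/funext => h; congr (_ *: (f _ - _)).
  by rewrite scalerDl addrCA /GRing.scale /= mulr1.
by move=> df; split; rewrite /derivable /derive /= E.
Qed.

(** The increment over s in [0, t] of s |-> f (x + s v + t w) - f (x + s v) is, by
the mean value theorem, t times a difference of two values of 'D_v f at points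
at distance O(t) from x.  The differentiability of 'D_v f at x, and not just the
existence of 'D_w ('D_v f) x, is what controls this difference up to o(t), as
the intermediate point s is unknown. *)
Lemma second_difference_near (R : realType) (U : normedModType R) (f : U -> R)
    (x v w : U) (e : R) :
  (\forall y \near x, differentiable f y) -> differentiable ('D_v f) x ->
  0 < e ->
  \forall t \near 0^'+,
    `|f (x + t *: v + t *: w) - f (x + t *: v) - f (x + t *: w) + f x
      - t ^+ 2 * 'D_w ('D_v f) x| <= e * t ^+ 2.
Proof.
move=> fd gd e0; pose g : U -> R := 'D_v f; rewrite -/g in gd *.
(* t M bounds the sum of the distances to x of the two points of evaluation *)
set M := `|v| + `|v| + `|w| + 1.
have M0 : 0 < M by rewrite ltr_pwDr// !addr_ge0.
have eM0 : 0 < e / M by rewrite divr_gt0.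
(* h is the remainder in the first order expansion of g at x *)
pose h u : R := g (x + u) - (g x + 'd g x u).
have hE : \forall u \near 0, `|h u| <= e / M * `|u|.
  have /eqaddoP/(_ _ eM0) := diff_locally gd.
  by apply: filterS => u; rewrite /h (addrC x); apply.
have /nbhs_norm0P[d /= d0 Hd] : \forall u \near (0 : U),
    differentiable f (x + u) /\ `|h u| <= e / M * `|u|.
  by apply: filterI => //;
     exact: (iffLR (nbhs0P (fun y : U => differentiable f y) x)).
near=> t.
have t0 : 0 < t by near: t; exact: nbhs_right_gt.
have td : t * M < d.
  rewrite -ltr_pdivlMr//; near: t; apply: nbhs_right_lt; exact: divr_gt0.
have smalld (u : U) : `|u| <= t * (`|v| + `|w|) -> `|u| < d.
  move=> /le_lt_trans; apply; apply: le_lt_trans td.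
  by rewrite ler_pM2l// /M; have := normr_ge0 v; lra.
have sv (s : R) : 0 <= s <= t -> `|s *: v| <= t * `|v|.
  by move=> /andP[s0 st]; rewrite normrZ ger0_norm// ler_wpM2r.
have s1 (s : R) : 0 <= s <= t -> `|s *: v| <= t * (`|v| + `|w|).
  by move=> /sv /le_trans; apply; rewrite ler_pM2l// lerDl.
have s2 (s : R) : 0 <= s <= t -> `|t *: w + s *: v| <= t * (`|v| + `|w|).
  move=> /sv st; rewrite (le_trans (ler_normD _ _))// addrC mulrDr lerD//.
  by rewrite normrZ gtr0_norm.
pose phi s := f (x + t *: w + s *: v) - f (x + s *: v).
have phid (s : R) : 0 <= s <= t ->
    is_derive s 1 phi (g (x + t *: w + s *: v) - g (x + s *: v)).
  move=> st; apply: is_deriveB; apply: is_derive_line; apply: diff_derivable.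
    by rewrite -addrA; apply: (Hd _ _).1; exact/smalld/s2.
  by apply: (Hd _ _).1; exact/smalld/s1.
have [||s sI phiE] := MVT_segment (ltW t0) (f := phi)
    (df := fun s => g (x + t *: w + s *: v) - g (x + s *: v)).
- by move=> s /[!in_itv]/= /andP[s0 st]; apply: phid; rewrite !ltW.
- apply: derivable_within_continuous => s /[!in_itv]/= st.
  by have [] := phid s st.
have {sI}st : 0 <= s <= t by rewrite in_itv in sI.
have dE : g (x + t *: w + s *: v) - g (x + s *: v)
    = t * 'D_w g x + (h (t *: w + s *: v) - h (s *: v)).
  have L : 'd g x (t *: w + s *: v) = t * 'd g x w + 'd g x (s *: v).
    by rewrite linearD linearZ.
  rewrite /h (deriveE _ gd) L -addrA; ring.
have -> : f (x + t *: v + t *: w) - f (x + t *: v) - f (x + t *: w) + f x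
    - t ^+ 2 * 'D_w g x = t * (h (t *: w + s *: v) - h (s *: v)).
  have -> : f (x + t *: v + t *: w) - f (x + t *: v) - f (x + t *: w) + f x
      = phi t - phi 0.
    rewrite /phi scale0r !addr0 (addrAC x); ring.
  rewrite phiE dE; ring.
rewrite normrM gtr0_norm// expr2 mulrCA ler_pM2l//.
rewrite (le_trans (ler_normB _ _))//.
have h1 : `|h (t *: w + s *: v)| <= e / M * (t * (`|v| + `|w|)).
  by rewrite (le_trans (Hd _ (smalld _ (s2 _ st))).2)// ler_pM2l// s2.
have h2 : `|h (s *: v)| <= e / M * (t * `|v|).
  by rewrite (le_trans (Hd _ (smalld _ (s1 _ st))).2)// ler_pM2l// sv.
rewrite (le_trans (lerD h1 h2))// -!mulrDr mulrCA mulrC ler_pM2r//.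
rewrite -[leRHS](divfK (lt0r_neq0 M0)) ler_pM2l// /M; lra.
Unshelve. all: by end_near. Qed.

(** The second difference of f over the parallelogram spanned by t v and t w is
symmetric in v and w, and divided by t^2 it tends to both mixed derivatives. *)
Lemma derive_comm (R : realType) (U : normedModType R) (f : U -> R)
    (x v w : U) :
  (\forall y \near x, differentiable f y) ->
  differentiable ('D_v f) x -> differentiable ('D_w f) x ->
  'D_w ('D_v f) x = 'D_v ('D_w f) x.
Proof.
move=> fd vd wd; apply/eqP; rewrite -subr_eq0 -normr_le0.
apply/ler_addgt0Pl => e e0; rewrite addr0.
have e20 : 0 < e / 2 by rewrite divr_gt0.
have H1 := second_difference_near w fd vd e20.
have H2 := second_difference_near v fd wd e20.
have /(_ _ _)/filter_ex[t [[t0 {}H1] {}H2]] :=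
  filterI (filterI (nbhs_right_gt (0 : R)) H1) H2.
set A := 'D_w ('D_v f) x in H1 *.
set B := 'D_v ('D_w f) x in H2 *.
rewrite -(ler_pM2l (exprn_gt0 2 t0)) -[X in X * _](gtr0_norm (exprn_gt0 2 t0)).
rewrite -normrM.
have -> : t ^+ 2 * (A - B) =
  (f (x + t *: w + t *: v) - f (x + t *: w) - f (x + t *: v) + f x - t ^+ 2 * B)
  - (f (x + t *: v + t *: w) - f (x + t *: v) - f (x + t *: w) + f x - t ^+ 2 * A).
  rewrite (addrAC x); ring.
apply: (le_trans (ler_normB _ _)); apply: (le_trans (lerD H2 H1)).
by rewrite -mulrDl -splitr mulrC.
Qed.

Lemma is_derive_affine (R : realType) (U : normedModType R) (F : U -> R)
    (u v : U) (l : R) :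
  (forall h : R, F (h *: v + u) = F u + h * l) -> is_derive u v F l.
Proof.
move=> FE.
have cv : (fun h : R => h^-1 *: (F (h *: v + u) - F u)) @ 0^' --> l.
  apply: (@cvg_trans _ ((fun=> l) @ (0 : R)^')); last exact: cvg_cst.
  apply: near_eq_cvg; near=> h.
  rewrite FE addrAC subrr add0r /GRing.scale /= mulKf//.
  by near: h; exact: nbhs_dnbhs_neq.
by split; [apply/cvg_ex; exists l | exact: cvg_lim].
Unshelve. all: by end_near. Qed.

(** * Eigen-forms of the matrix a *)

Lemma eigen_form_a_mx (R : realType) (K1 K2 C111 C112 C122 C222 : R)
    (u p : 'rV[R]_4) (l : R) :
  p *m a_mx K1 K2 C111 C112 C122 C222 u = l *: p ->
  let c := c_fun C112 C122 u in
  let d1 := d1_fun K1 C111 C112 u in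
  let d2 := d2_fun K2 C122 C222 u in
  [/\ d1 * p 0 3 - c * p 0 2 = l * p 0 0,
      c * p 0 3 - d2 * p 0 2 = l * p 0 1,
      - p 0 1 = l * p 0 2 &
      p 0 0 = l * p 0 3].
Proof.
move=> /matrixP E c d1 d2.
have Ej j := E 0 j.
have o0 : ord0 = 0 :> 'I_4 by [].
have o1 : lift ord0 ord0 = 1 :> 'I_4 by apply/val_inj.
have o2 : lift ord0 (lift ord0 ord0) = 2 :> 'I_4 by apply/val_inj.
have o3 : lift ord0 (lift ord0 (lift ord0 ord0)) = 3 :> 'I_4 by apply/val_inj.
have {}Ej j : p 0 0 * a_mx K1 K2 C111 C112 C122 C222 u 0 j
  + p 0 1 * a_mx K1 K2 C111 C112 C122 C222 u 1 j
  + p 0 2 * a_mx K1 K2 C111 C112 C122 C222 u 2 j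
  + p 0 3 * a_mx K1 K2 C111 C112 C122 C222 u 3 j = l * p 0 j.
  have := Ej j; rewrite [X in X = _]mxE [X in _ = X]mxE.
  rewrite !big_ord_recl big_ord0 o1 o2 o3 o0 addr0 => <-.
  by rewrite !addrA.
have E0 := Ej 0; have E1 := Ej 1; have E2 := Ej 2; have E3 := Ej 3.
rewrite !mxE /= -/c -/d1 -/d2 in E0 E1 E2 E3.
by split; rewrite -?E0 -?E1 -?E2 -?E3; ring.
Qed.

(** Elimination of the eigenvalue, about which no regularity is known, leaves
relations that can be differentiated. *)
Lemma eigen_form_relations (R : realType) (K1 K2 C111 C112 C122 C222 : R)
    (u p : 'rV[R]_4) (l : R) :
  p *m a_mx K1 K2 C111 C112 C122 C222 u = l *: p ->
  let c := c_fun C112 C122 u in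
  let d1 := d1_fun K1 C111 C112 u in
  let d2 := d2_fun K2 C122 C222 u in
  [/\ p 0 0 * p 0 2 + p 0 1 * p 0 3 = 0,
      c * (p 0 3 * p 0 3) + (d1 - d2) * (p 0 2 * p 0 3) - c * (p 0 2 * p 0 2) = 0 &
      p 0 0 * p 0 0 - (d1 * p 0 3 - c * p 0 2) * p 0 3 = 0].
Proof.
move=> /eigen_form_a_mx[]; set c := c_fun _ _ _; set d1 := d1_fun _ _ _ _.
set d2 := d2_fun _ _ _ _ => E0 E1 E2 E3; split.
- by rewrite -[p 0 1]opprK E2 E3; ring.
- have -> : c * (p 0 3 * p 0 3) + (d1 - d2) * (p 0 2 * p 0 3)
    - c * (p 0 2 * p 0 2) =
    (c * p 0 3 - d2 * p 0 2) * p 0 3 + (d1 * p 0 3 - c * p 0 2) * p 0 2 by ring.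
  by rewrite E0 E1 E3 -[p 0 1]opprK E2; ring.
- by rewrite E0 E3; ring.
Qed.

(** Coincides with [differential f] where f is differentiable, but its components
are literally the functions [partial j f], which can be differentiated again. *)
Definition gradient (R : realType) (n : nat) (f : 'rV[R]_n -> R)
    (u : 'rV[R]_n) : 'rV[R]_n := \row_j partial j f u.

(** The three relations are differentiated at 0, where the second and third
components of the gradient vanish, and the symmetry of the Hessian H then
leaves no room for a nonzero derivative of c. *)
Lemma eigen_gradient_uncoupled (R : realType) (K1 K2 C111 C112 C122 C222 : R)
    (f : 'rV[R]_4 -> R) :
  0 < K1 -> K1 != K2 ->
  (\forall u \near (0 : 'rV[R]_4), differentiable f u) ->
  (forall k, differentiable (partial k f) 0) ->
  (\forall u \near (0 : 'rV[R]_4), exists l : R,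
     gradient f u *m a_mx K1 K2 C111 C112 C122 C222 u = l *: gradient f u) ->
  partial 3 f 0 != 0 -> C112 = 0 /\ C122 = 0.
Proof.
move=> K10 K12 fd qd eig q30.
pose q k := partial k f.
pose c := c_fun C112 C122.
pose d1 := d1_fun K1 C111 C112.
pose d2 := d2_fun K2 C122 C222.
have rel : \forall u \near (0 : 'rV[R]_4),
    [/\ (q 0 * q 2 + q 1 * q 3) u = 0,
        (c * (q 3 * q 3) + (d1 - d2) * (q 2 * q 3) - c * (q 2 * q 2)) u = 0 &
        (q 0 * q 0 - (d1 * q 3 - c * q 2) * q 3) u = 0].
  apply: filterS eig => u [l /eigen_form_relations].
  by rewrite !mxE.
pose H (i k : 'I_4) : R := 'D_(delta_mx 0 i) (q k) 0.
have Hsym (i k : 'I_4) : H i k = H k i by exact: (derive_comm fd (qd k) (qd i)).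
have c0 : c 0 = 0 by rewrite /c /c_fun !mxE; ring.
have d10 : d1 0 = K1 by rewrite /d1 /d1_fun !mxE; ring.
have d20 : d2 0 = K2 by rewrite /d2 /d2_fun !mxE; ring.
have D0 (F : 'rV[R]_4 -> R) (v : 'rV[R]_4) (L : R) :
    is_derive 0 v F L -> (\forall u \near (0 : 'rV[R]_4), F u = 0) -> L = 0.
  move=> FL F0.
  have [_ <-] := @near_eq_is_derive R 'rV[R]_4 R F (cst 0) 0 v L F0 FL.
  exact: derive_cst.
have qD (i k : 'I_4) : is_derive 0 (delta_mx 0 i) (q k) (H i k).
  by apply: derivableP; apply: diff_derivable; exact: qd.
pose dc (v : 'rV[R]_4) := 2 * C112 * v 0 0 + 2 * C122 * v 0 1.
pose dd1 (v : 'rV[R]_4) := 6 * C111 * v 0 0 + 2 * C112 * v 0 1.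
pose dd2 (v : 'rV[R]_4) := 2 * C122 * v 0 0 + 6 * C222 * v 0 1.
have cD (v : 'rV[R]_4) : is_derive 0 v c (dc v).
  by apply: is_derive_affine => h; rewrite /c /dc /c_fun !mxE; ring.
have d1D (v : 'rV[R]_4) : is_derive 0 v d1 (dd1 v).
  by apply: is_derive_affine => h; rewrite /d1 /dd1 /d1_fun !mxE; ring.
have d2D (v : 'rV[R]_4) : is_derive 0 v d2 (dd2 v).
  by apply: is_derive_affine => h; rewrite /d2 /dd2 /d2_fun !mxE; ring.
have {}q30 : q 3 0 != 0 := q30.
(* ring is to treat these functions as atoms *)
clearbody q H c d1 d2.
have [rel1 rel2 rel3] := nbhs_singleton rel.
have {}rel1 : q 0 0 * q 2 0 + q 1 0 * q 3 0 = 0 := rel1.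
have {}rel2 : c 0 * (q 3 0 * q 3 0) + (d1 0 - d2 0) * (q 2 0 * q 3 0)
  - c 0 * (q 2 0 * q 2 0) = 0 := rel2.
have {}rel3 : q 0 0 * q 0 0 - (d1 0 * q 3 0 - c 0 * q 2 0) * q 3 0 = 0 := rel3.
rewrite c0 d10 d20 in rel2 rel3.
have K12' : K1 - K2 != 0 by rewrite subr_eq0.
have q20 : q 2 0 = 0.
  by apply: (mulfI K12'); apply: (mulIf q30); rewrite -mulrA; lra.
have q10 : q 1 0 = 0.
  by move: rel1; rewrite q20 mulr0 add0r => /eqP;
     rewrite mulf_eq0 (negPf q30) orbF => /eqP.
have q00 : q 0 0 != 0.
  apply/eqP => q00; move: rel3; rewrite q00 => /eqP.
  by rewrite !(mul0r, subr0, sub0r) oppr_eq0 !mulf_eq0 (gt_eqF K10) (negbTE q30).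
(* the derivatives of the three relations in the direction 'e_i *)
have E1 (i : 'I_4) : q 0 0 * H i 2 + q 3 0 * H i 1 = 0.
  have := D0 _ _ _ (is_deriveD (is_deriveM (qD i 0) (qD i 2))
                               (is_deriveM (qD i 1) (qD i 3))).
  rewrite q10 q20 /GRing.scale /= => E.
  by rewrite -[RHS]E; [ring | apply: filterS rel => u []].
have E2 (i : 'I_4) : dc 'e_i * q 3 0 + (K1 - K2) * H i 2 = 0.
  have /(_ _)E := D0 _ _ _ (is_deriveB
    (is_deriveD (is_deriveM (cD 'e_i) (is_deriveM (qD i 3) (qD i 3)))
      (is_deriveM (is_deriveB (d1D 'e_i) (d2D 'e_i)) (is_deriveM (qD i 2) (qD i 3))))
    (is_deriveM (cD 'e_i) (is_deriveM (qD i 2) (qD i 2)))).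
  have {}E := E ltac:(by apply: filterS rel => u []).
  rewrite /GRing.scale /= !fctE c0 d10 d20 q20 in E.
  apply: (mulIf q30); rewrite mul0r -[RHS]E; ring.
have E3 (i : 'I_4) : 2 * q 0 0 * H i 0
    = (dd1 'e_i * q 3 0 + 2 * K1 * H i 3) * q 3 0.
  have /(_ _)E := D0 _ _ _ (is_deriveB (is_deriveM (qD i 0) (qD i 0))
    (is_deriveM (is_deriveB (is_deriveM (d1D 'e_i) (qD i 3))
      (is_deriveM (cD 'e_i) (qD i 2))) (qD i 3))).
  have {}E := E ltac:(by apply: filterS rel => u []).
  rewrite /GRing.scale /= !fctE c0 d10 q20 in E.
  apply/eqP; rewrite -subr_eq0 -[X in _ == X]E; apply/eqP; ring.
have dc_row0 : dc 'e_0 = 2 * C112 by rewrite /dc !mxE /=; ring.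
have dc_row1 : dc 'e_1 = 2 * C122 by rewrite /dc !mxE /=; ring.
have dc_row2 : dc 'e_2 = 0 by rewrite /dc !mxE /=; ring.
have dd1_row2 : dd1 'e_2 = 0 by rewrite /dd1 !mxE /=; ring.
have H22 : H 2 2 = 0.
  by apply: (mulfI K12'); rewrite mulr0 -[RHS](E2 2) dc_row2; ring.
have H21 : H 2 1 = 0.
  by apply: (mulfI q30); rewrite mulr0 -[RHS](E1 2) H22; ring.
have H32 : H 3 2 = 0.
  apply: (mulfI K12'); rewrite mulr0 -[RHS](E2 3) /dc !mxE /=; ring.
have H20 : H 2 0 = 0.
  have := E3 2; rewrite dd1_row2 (Hsym 2 3) H32 => E.
  have /eqP : 2 * q 0 0 * H 2 0 = 0 by rewrite E; ring.
  by rewrite !mulf_eq0 pnatr_eq0 (negPf q00) => /eqP.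
have K0 (i : 'I_4) : H i 2 = 0 -> dc 'e_i = 0.
  move=> Hi; apply: (mulIf q30); rewrite mul0r -[RHS](E2 i) Hi; ring.
by split; [have := K0 0; rewrite dc_row0 | have := K0 1; rewrite dc_row1];
  rewrite (Hsym _ 2) ?H20 ?H21 => /(_ erefl); lra.
Qed.

(** * Riemann invariants *)

Lemma differential_gradient (R : realType) (n : nat) (f : 'rV[R]_n -> R)
    (u : 'rV[R]_n) :
  differentiable f u -> differential f u = gradient f u.
Proof. by move=> fu; apply/rowP => j; rewrite !mxE /partial deriveE. Qed.

(** Three distinct numbers cannot have the same square. *)
Lemma exists_sqr_neq (R : realType) (l : 'I_4 -> R) (a : R) :
  injective l -> exists i, l i ^+ 2 != a.
Proof.
move=> inj; apply/not_existsP => H.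
have {}H i : l i ^+ 2 = a by apply/eqP/negPn/negP => /H.
have opp i j : i != j -> l j = - l i.
  move=> ij; apply/eqP; have /eqP := H i; rewrite -(H j) eqf_sqr.
  by case/orP=> /eqP E; [rewrite (inj _ _ E) eqxx in ij | rewrite E opprK].
suff /inj : l 1 = l 2 by [].
by rewrite (opp 0 1)// (opp 0 2).
Qed.

Theorem mainTheorem3 (R : realType) (K1 K2 C111 C112 C122 C222 : R)
    (hK2 : 0 < K2) (hK21 : K2 < K1) (hK1 : K1 < 1)
    (hc : exists u : 'rV[R]_4, c_fun C112 C122 u != 0)
    (V : set 'rV[R]_4) (hV : open_nbhs (0 : 'rV[R]_4) V) :
  ~ admits_riemann_invariants (a_mx K1 K2 C111 C112 C122 C222) V.
Proof.
move=> [l [e [m [mu [eigl eige _ [msm _ _] mue]]]]].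
have [_ V0] := hV.
have VN : nbhs (0 : 'rV[R]_4) V by exact: open_nbhs_nbhs.
have [i li] := exists_sqr_neq K2 (eigl 0 V0).1.
pose f v := m v 0 i.
have fV u : V u -> differentiable f u by exact: (msm i [::]).
have eigf u : V u -> gradient f u != 0 /\
    gradient f u *m a_mx K1 K2 C111 C112 C122 C222 u = l i u *: gradient f u.
  move=> Vu; have [e0 eE] := eige i u Vu.
  have me := mue i u Vu; rewrite -/f differential_gradient in me; last exact: fV.
  have mu0 : mu i u != 0.
    by apply: contraNneq e0 => mu0; rewrite -me mu0 scale0r.
  split; first by apply: contraNneq e0 => g0; rewrite -me g0 scaler0.
  by apply: (scalerI mu0); rewrite scalemxAl me eE -me !scalerA mulrC.
(* if p4 = 0 then p3 <> 0 would make l^2 equal to K2, and p3 = 0 makes p = 0 *)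
have f3 : partial 3 f 0 != 0.
  have [g0 /eigen_form_a_mx[_ + + +]] := eigf 0 V0.
  have -> : c_fun C112 C122 (0 : 'rV[R]_4) = 0 by rewrite /c_fun !mxE; ring.
  have -> : d2_fun K2 C122 C222 (0 : 'rV[R]_4) = K2 by rewrite /d2_fun !mxE; ring.
  have -> : partial 3 f 0 = gradient f 0 0 3 by rewrite mxE.
  set p := gradient f 0 in g0 * => E1 E2 E3.
  apply: contraNneq g0 => p3.
  have p0 : p 0 0 = 0 by rewrite E3 p3 mulr0.
  have p2 : p 0 2 = 0.
    apply: contraNeq li => p20; apply/eqP; apply: (mulIf p20).
    rewrite expr2 -mulrA -E2 mulrN -E1 p3; ring.
  have p1 : p 0 1 = 0 by rewrite -[LHS]opprK E2 p2 mulr0 oppr0.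
  apply/eqP/rowP => j; rewrite [RHS]mxE.
  case: j => [[|[|[|[|//]]]] lt];
    [rewrite -[RHS]p0 | rewrite -[RHS]p1 | rewrite -[RHS]p2 | rewrite -[RHS]p3];
    by congr (p _ _); apply/val_inj.
have [C1 C2] : C112 = 0 /\ C122 = 0.
  apply: (@eigen_gradient_uncoupled R K1 K2 C111 C112 C122 C222 f) => //.
  - exact: lt_trans hK21.
  - by rewrite gt_eqF.
  - by apply: filterS VN => u; exact: fV.
  - by move=> k; exact: (msm i [:: k]).
  - by apply: filterS VN => u /eigf[_ E]; exists (l i u).
by case: hc => u; rewrite /c_fun C1 C2 !(mulr0, mul0r) addr0 eqxx.
Qed.
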